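(* Fix any constant $C\ge1$, a set $P\subseteq\mathbb{R}^d$ (of positive examples), and a distribution $\mathcal{Q}$ over $\mathbb{R}^d$. Let $\mathcal{P}$ be the truncation of $\mathcal{Q}$ to $P$. Let $\mathcal{U}$ be any distribution with the same support as $\mathcal{Q}$ satisfying, for every set $T\subseteq\mathbb{R}^d$, $$e^{-C}\cdot\mathcal{U}(T)^{C}\le\mathcal{Q}(T)\le e^{C}\cdot\mathcal{U}(T)^{1/C}.$$ For any $0<\rho<1/(3C)$, let $\mathcal{D}=\rho\cdot\mathcal{D}_{\mathcal{U}}+(1-\rho)\cdot\mathcal{D}_{\mathcal{P}}$ be the distribution over $\mathbb{R}^d\times\{0,1\}$ where $(x,y)\sim\mathcal{D}_{\mathcal{U}}$ is generated by drawing $x\sim\mathcal{U}$ and setting $y=0$, and $(x,y)\sim\mathcal{D}_{\mathcal{P}}$ is generated by drawing $x\sim\mathcal{P}$ and setting $y=1$. Then, for every $S\subseteq\mathbb{R}^d$, $$\mathcal{Q}(S\triangle P)\le O(\rho)+O\left(\frac{e^C}{\rho}\right)\cdot\left(\mathrm{Err}_{\mathcal{D}}(S)-\mathrm{Err}_{\mathcal{D}}(S_{\mathrm{OPT}})\right)^{1/C},$$ where, for any set $T$, $\mathrm{Err}_{\mathcal{D}}(T)=\Pr_{(x,y)\sim\mathcal{D}}[y\ne\mathbf{1}_T(x)]$ and $S_{\mathrm{OPT}}\in\arg\min_{T\subseteq\mathbb{R}^d}\mathrm{Err}_{\mathcal{D}}(T)$.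
   Context: The truncation of $\mathcal{Q}$ to $P$ is $\mathcal{Q}$ conditioned on $x\in P$ (so $\mathcal{Q}(P)>0$). For a distribution $\mathcal{D}'$ on $\mathbb{R}^d$, $\mathcal{D}'(T)=\Pr_{x\sim\mathcal{D}'}[x\in T]$. Sets are understood to be measurable and distributions to have densities. $S\triangle P$ is the symmetric difference and $\mathbf{1}_T$ the indicator of $T$. The constants hidden in $O(\cdot)$ are universal. *)

(* Defs.v *)
From HB Require Import structures.
From mathcomp Require Import all_boot all_order all_algebra.
From mathcomp Require Import all_classical all_reals all_analysis.
Import Order.TTheory GRing.Theory Num.Theory numFieldNormedType.Exports.

Set Implicit Arguments.
Unset Strict Implicit.
Unset Printing Implicit Defensive.

Local Open Scope classical_set_scope.
Local Open Scope ring_scope.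

(* R^d with its Borel sigma-algebra. *)
Notation Rd R d := (g_sigma_algebraType (@open 'rV[R]_d)).

Section lebesgue_cons.
Context (R : realType) (d : nat).
Variable mu : {sigma_finite_measure set (d.-tuple (measurableTypeR R)) -> \bar R}.

Definition tuple_of_pair (xt : measurableTypeR R * d.-tuple (measurableTypeR R)) :
  d.+1.-tuple (measurableTypeR R) := cons_tuple xt.1 xt.2.

Lemma measurable_tuple_of_pair : measurable_fun setT tuple_of_pair.
Proof. exact: measurable_cons. Qed.

Definition lebesgue_cons : set (d.+1.-tuple (measurableTypeR R)) -> \bar R :=
  pushforward (@lebesgue_measure R \x mu)%E tuple_of_pair.

Let lebesgue_cons0 : lebesgue_cons set0 = 0%E.
Proof. by rewrite /lebesgue_cons /pushforward preimage_set0 measure0. Qed.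

Let lebesgue_cons_ge0 A : (0 <= lebesgue_cons A)%E.
Proof. exact: (measure_ge0 (@lebesgue_measure R \x mu)%E). Qed.

Let lebesgue_cons_sigma_additive : semi_sigma_additive lebesgue_cons.
Proof.
exact: (@measure_semi_sigma_additive _ _ _
  (measure_function_pushforward__canonical__measure_function_Measure
     (@lebesgue_measure R \x mu)%E measurable_tuple_of_pair)).
Qed.

HB.instance Definition _ := isMeasure.Build _ _ _ lebesgue_cons
  lebesgue_cons0 lebesgue_cons_ge0 lebesgue_cons_sigma_additive.

Let lebesgue_cons_sigma_finite : sigma_finite setT lebesgue_cons.
Proof.
have /sigma_finiteP[F [FT ndF mF]] := sigma_finiteT (@lebesgue_measure R).
have /sigma_finiteP[G [GT ndG mG]] := sigma_finiteT mu.
pose g (t : d.+1.-tuple (measurableTypeR R)) :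
    measurableTypeR R * d.-tuple (measurableTypeR R) :=
  (tnth t ord0, [tuple of behead t]).
have mg : measurable_fun setT g.
  apply/measurable_fun_pairP; split; first exact: measurable_tnth.
  exact: measurable_behead.
have gK xt : g (tuple_of_pair xt) = xt.
  by case: xt => x t; congr pair; apply/val_inj.
exists (fun n => g @^-1` (F n `*` G n)).
  rewrite -preimage_bigcup (_ : \bigcup_n _ = setT) ?preimage_setT//.
  apply/seteqP; split => // -[x t] _.
  have [k _ Fx] : (\bigcup_n F n) x by rewrite -FT.
  have [l _ Gt] : (\bigcup_n G n) t by rewrite -GT.
  exists (maxn k l) => //; split => /=.
    by move: Fx; exact/subsetPset/ndF/leq_maxl.
  by move: Gt; exact/subsetPset/ndG/leq_maxr.
move=> n; have [mFn Fnoo] := mF n; have [mGn Gnoo] := mG n; split.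
  by rewrite -[X in measurable X]setTI; apply: mg => //; exact: measurableX.
rewrite /lebesgue_cons /pushforward -comp_preimage.
rewrite (_ : g \o tuple_of_pair = id); last exact/funext.
by rewrite preimage_id product_measure1E// lte_mul_pinfty// ge0_fin_numE.
Qed.

HB.instance Definition _ := Measure_isSigmaFinite.Build _ _ _ lebesgue_cons
  lebesgue_cons_sigma_finite.

End lebesgue_cons.

Fixpoint lebesgue_tuple (R : realType) (d : nat) :
    {sigma_finite_measure set (d.-tuple (measurableTypeR R)) -> \bar R} :=
  match d with
  | 0 => dirac ([tuple] : 0.-tuple (measurableTypeR R))
  | d'.+1 => lebesgue_cons (lebesgue_tuple R d')
  end.

Lemma lebesgue_tuple_box (R : realType) (d : nat) (a b : 'I_d -> R) :
  (forall i, a i <= b i) ->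
  lebesgue_tuple R d [set t | forall i, a i < tnth t i <= b i] =
  (\prod_i (b i - a i))%:E.
Proof.
pose B n (u v : 'I_n -> R) : set (n.-tuple (measurableTypeR R)) :=
  [set t | forall i, u i < tnth t i <= v i].
have mB n u v : measurable (@B n u v).
  have -> : B n u v = \bigcap_(i in [set: 'I_n])
      ((fun t : n.-tuple (measurableTypeR R) => tnth t i) @^-1` `]u i, v i]).
    apply/seteqP; split => t /= H i; last by have := H i I; rewrite /= in_itv.
    by move=> _ /=; rewrite in_itv; exact: H.
  apply: fin_bigcap_measurable; first exact: finite_finset.
  by move=> i _; rewrite -[X in measurable X]setTI; exact: measurable_tnth.
elim: d a b => [|d IH] a b ab.
  rewrite big_ord0 /= /dirac indicE mem_set// => -[]//.
rewrite /= /lebesgue_cons /pushforward big_ord_recl.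
have -> : tuple_of_pair (d := d) @^-1`
    [set t | forall i, a i < tnth t i <= b i] =
    `]a ord0, b ord0] `*` B d (a \o lift ord0) (b \o lift ord0).
  apply/seteqP; split => [[x t]/= H|[x t]/= [+ H] i].
    split=> [|i]; first by rewrite /= in_itv; exact: (H ord0).
    by have := H (lift ord0 i); rewrite tnthS.
  rewrite in_itv/= => x0; have [->//|i0] := eqVneq i ord0.
  have [j ->] : exists j, i = lift ord0 j.
    by case: (unliftP ord0 i) i0 => [j ->|->]; [exists j|rewrite eqxx].
  by rewrite tnthS; exact: H.
rewrite product_measure1E//=; last exact: mB.
have -> : lebesgue_tuple R d (B d (a \o lift ord0) (b \o lift ord0)) =
    (\prod_i (b (lift ord0 i) - a (lift ord0 i)))%:E.
  by rewrite IH// => i; exact: ab.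
rewrite (lebesgue_measure_itv `]a ord0, b ord0]) /= lte_fin EFinM; congr (_ * _)%E.
by case: ltP => // /(conj (ab ord0)) /andP; rewrite -eq_le => /eqP ->; rewrite subrr.
Qed.

Definition row_of_tuple (R : realType) (d : nat)
    (t : d.-tuple (measurableTypeR R)) : Rd R d :=
  \row_i tnth t i.

Lemma measurable_row_of_tuple (R : realType) (d : nat) :
  measurable_fun setT (@row_of_tuple R d).
Proof.
apply: (@measurability _ _ _ (Rd R d) setT _ (@open 'rV[R]_d)) => //.
move=> _ [U oU <-]; rewrite setTI.
pose F (p : {ffun 'I_d -> rat} * nat) : set (d.-tuple (measurableTypeR R)) :=
  [set t | forall i, `|ratr (p.1 i) - tnth t i| < p.2.+1%:R^-1].
have mF p : measurable (F p).
  have -> : F p = \bigcap_(i in [set: 'I_d])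
     ((fun t : d.-tuple (measurableTypeR R) => tnth t i) @^-1` 
         ball (ratr (p.1 i) : R) p.2.+1%:R^-1).
    by apply/seteqP; split => t /= H i; [move=> _|]; apply: H.
  apply: fin_bigcap_measurable; first exact: finite_finset.
  move=> i _; rewrite -[X in measurable X]setTI; apply: measurable_tnth => //.
  apply: measurable_realfun.open_measurable; exact: ball_open.
rewrite [X in measurable X](_ : _ = \bigcup_(p in
   [set p | F p `<=` @row_of_tuple R d @^-1` U]) F p).
  rewrite bigcup_mkcond; apply: countable_bigcupT_measurable => //.
  by move=> p; case: ifPn.
apply/seteqP; split => [t /= Ut|t [p]]; last by apply.
have : nbhs (row_of_tuple t) U by apply: open_nbhs_nbhs; split.
rewrite -nbhs_ballE => -[e /= e0 eU].
have [n ne] : exists n : nat, n.+1%:R^-1 < e / 2 :> R.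
  have e20 : 0 < e / 2 by exact: divr_gt0.
  have [N _ /(_ N (leqnn N))] := near_infty_natSinv_lt (PosNum e20).
  by move=> ?; exists N.
have n0 : 0 < n.+1%:R^-1 :> R by rewrite invr_gt0.
pose q i := xget (0 : rat) [set r : rat | `|ratr r - tnth t i| < n.+1%:R^-1].
have qP i : `|ratr (q i) - tnth t i| < n.+1%:R^-1.
  apply: (@xgetPex _ 0 [set r : rat | `|ratr r - tnth t i| < n.+1%:R^-1]).
  have : tnth t i - n.+1%:R^-1 < tnth t i + n.+1%:R^-1.
    by rewrite ltrBlDr -addrA ltrDl addr_gt0.
  move=> /rat_in_itvoo[r]; rewrite in_itv/= => /andP[h1 h2].
  by exists r => /=; rewrite ltr_distl h1 h2.
exists ([ffun i => q i], n); last by move=> i /=; rewrite ffunE.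
move=> s /= Fs; apply: eU; split => // i j.
rewrite /row_of_tuple !mxE /ball/= (splitr e).
rewrite (le_lt_trans (ler_distD (ratr (q j)) _ _))// ltrD//.
  by rewrite distrC (lt_trans (qP j)).
by have := Fs j; rewrite ffunE => /lt_trans; apply.
Qed.

Section lebesgue_Rd.
Context (R : realType) (d : nat).

Definition lebesgue_Rd : set (Rd R d) -> \bar R :=
  pushforward (lebesgue_tuple R d) (@row_of_tuple R d).

Let lebesgue_Rd0 : lebesgue_Rd set0 = 0%E.
Proof. by rewrite /lebesgue_Rd /pushforward preimage_set0 measure0. Qed.

Let lebesgue_Rd_ge0 A : (0 <= lebesgue_Rd A)%E.
Proof. exact: (measure_ge0 (lebesgue_tuple R d)). Qed.

Let lebesgue_Rd_sigma_additive : semi_sigma_additive lebesgue_Rd.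
Proof.
exact: (@measure_semi_sigma_additive _ _ _
  (measure_function_pushforward__canonical__measure_function_Measure
     (lebesgue_tuple R d) (@measurable_row_of_tuple R d))).
Qed.

HB.instance Definition _ := isMeasure.Build _ _ _ lebesgue_Rd
  lebesgue_Rd0 lebesgue_Rd_ge0 lebesgue_Rd_sigma_additive.

Lemma lebesgue_Rd_box (a b : 'I_d -> R) : (forall i, a i <= b i) ->
  lebesgue_Rd [set x | forall i, a i < (x : 'rV[R]_d) 0 i <= b i] =
  (\prod_i (b i - a i))%:E.
Proof.
move=> ab; rewrite -(lebesgue_tuple_box ab) /lebesgue_Rd /pushforward.
by congr (lebesgue_tuple R d _); apply/seteqP; split => t /= h i;
  have := h i; rewrite mxE.
Qed.

End lebesgue_Rd.
Arguments lebesgue_Rd : clear implicits.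

Definition has_density (R : realType) (d : nat) (mu : set (Rd R d) -> \bar R) :=
  exists f : Rd R d -> R,
    [/\ measurable_fun setT f, forall x, 0 <= f x &
        forall A, measurable A ->
          mu A = (\int[lebesgue_Rd R d]_(x in A) (f x)%:E)%E].

Definition measure_support (R : realType) (d : nat) (mu : set (Rd R d) -> \bar R) :
    set 'rV[R]_d :=
  [set x | forall V : set 'rV[R]_d, open_nbhs x V -> (0 < mu V)%E].

Section classification.
Context (R : realType) (disp : measure_display) (T : measurableType disp).
Implicit Types (Q U : probability T R) (D : set (T * bool) -> \bar R).

(* When Q P = 0 the normalization is the junk value Q itself. *)
Definition truncation Q (P : set T) (mP : measurable P) : probability T R :=
  mnormalize (mrestr Q mP) Q.

(* The law of (x, y) for x drawn from mu and y constant. *)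
Definition labeled (mu : set T -> \bar R) (y : bool) : set (T * bool) -> \bar R :=
  pushforward mu (fun x => (x, y)).

Definition mixture (rho : R) (mu nu : set (T * bool) -> \bar R) :
    set (T * bool) -> \bar R :=
  fun A => (rho%:E * mu A + (1 - rho)%:E * nu A)%E.

Definition Err D (S : set T) : R :=
  fine (D [set z | z.2 != (z.1 \in S)]).

Definition is_argmin_Err D (S : set T) :=
  measurable S /\ forall S' : set T, measurable S' -> Err D S <= Err D S'.

End classification.

(* Main.v *)
Require Import Defs.
From mathcomp Require Import all_boot all_order all_algebra.
From mathcomp Require Import all_classical all_reals all_analysis.
From mathcomp Require Import lra.
Import Order.TTheory GRing.Theory Num.Theory numFieldNormedType.Exports.

(** Write [e] for the excess error of [S]. Deleting [S \ P] from [S] lowers the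
    error by [rho U(S \ P)], so [rho U(S \ P) <= e], and the upper comparison
    between [Q] and [U] bounds [Q(S \ P)]. Adding [P \ S] to [S] lowers the
    error by [(1 - rho) Q(P \ S) / Q(P) - rho U(P \ S)], so this is at most [e]
    as well; bounding [U(P \ S)] and [Q(P)] by 1 gives
    [(1 - rho) Q(P \ S) <= e + rho]. Finally [e <= e^(1/C)] since [e <= 1]. *)

Local Open Scope classical_set_scope.
Local Open Scope ring_scope.

Section probability_fine.
Context {R : realType} {disp : measure_display} {T : measurableType disp}.
Variable mu : probability T R.

Lemma fine_probability_ge0 (A : set T) : 0 <= fine (mu A).
Proof. exact: fine_ge0. Qed.

Lemma fine_probability_le1 (A : set T) : measurable A -> fine (mu A) <= 1.
Proof.
move=> mA; rewrite -lee_fin fineK ?fin_num_measure//.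
exact: probability_le1.
Qed.

Lemma fine_probabilityDI (A B : set T) : measurable A -> measurable B ->
  fine (mu A) = fine (mu (A `\` B)) + fine (mu (A `&` B)).
Proof.
move=> mA mB; rewrite [in LHS](measureDI mu mA mB) fineD//;
  apply: fin_num_measure; [exact: measurableD|exact: measurableI].
Qed.

End probability_fine.

Section positive_unlabeled_error.
Context {R : realType} {disp : measure_display} {T : measurableType disp}.

(** Points drawn from [U] carry label 0 and are misclassified exactly on [S]; points drawn from [N]
    carry label 1 and are misclassified exactly off [S]. *)
Lemma Err_mixture (rho : R) (U N : probability T R) (S : set T) :
  measurable S ->
  Err (mixture rho (labeled U false) (labeled N true)) S =
  rho * fine (U S) + (1 - rho) * fine (N (~` S)).
Proof.
move=> mS; rewrite /Err /mixture /labeled /pushforward.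
have -> : (fun x : T => (x, false)) @^-1` [set z | z.2 != (z.1 \in S)] = S.
  apply/seteqP; split => x /=; last by move=> Sx; rewrite mem_set.
  by rewrite eq_sym eqbF_neg negbK => /set_mem.
have -> : (fun x : T => (x, true)) @^-1` [set z | z.2 != (z.1 \in S)] = ~` S.
  apply/seteqP; split => x /=; last by move=> Sx; rewrite memNset.
  by move=> h Sx; move: h; rewrite mem_set.
rewrite -(fineK (fin_num_measure U S mS)).
rewrite -(fineK (fin_num_measure N _ (measurableC mS))).
by rewrite -!EFinM -EFinD.
Qed.

(** Positivity of [Q P] excludes the default branch of [mnormalize], leaving the usual conditional
    probability. *)
Lemma fine_truncation (Q : probability T R) (P : set T) (mP : measurable P)
    (A : set T) : (0 < Q P)%E -> measurable A ->
  fine (truncation Q mP A) = fine (Q (A `&` P)) / fine (Q P).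
Proof.
move=> Q0 mA; rewrite /truncation /= /mnormalize /= /mrestr setTI.
rewrite gt_eqF//= lt_eqF ?ltey_eq ?fin_num_measure//=.
by rewrite -[in LHS](fineK (fin_num_measure Q _ (measurableI _ _ mA mP))).
Qed.

Variables (rho : R) (Q U : probability T R) (P : set T) (mP : measurable P).
Hypotheses (rho01 : 0 < rho < 1) (QP0 : (0 < Q P)%E).

Let D := mixture rho (labeled U false) (labeled (truncation Q mP) true).

Lemma Err_ge0 (S : set T) : measurable S -> 0 <= Err D S.
Proof.
move=> mS; rewrite Err_mixture//; case/andP: rho01 => r0 r1.
by rewrite addr_ge0// mulr_ge0 ?fine_probability_ge0//; lra.
Qed.

(** With [Err_ge0], this places the excess error below 1, where raising it to the power [C^-1] can
    only increase it. *)
Lemma Err_le1 (S : set T) : measurable S -> Err D S <= 1.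
Proof.
move=> mS; rewrite Err_mixture//; case/andP: rho01 => r0 r1.
have u1 := fine_probability_le1 U _ mS.
have n1 := fine_probability_le1 (truncation Q mP) _ (measurableC mS).
nra.
Qed.

(** Intersecting with [P] loses no positive example, so the truncation terms cancel and only the [U]
    terms differ. *)
Lemma Err_setI (S : set T) : measurable S ->
  Err D S - Err D (S `&` P) = rho * fine (U (S `\` P)).
Proof.
move=> mS; have mSP := measurableI _ _ mS mP.
rewrite !Err_mixture// !fine_truncation//; try exact: measurableC.
rewrite (_ : ~` (S `&` P) `&` P = ~` S `&` P); last first.
  by rewrite setCI setIUl [~` P `&` P]setIC setICr setU0.
by rewrite (fine_probabilityDI U _ _ mS mP); lra.
Qed.

(** The union misses no positive example, so its truncation term vanishes; the price is the extra
    [U]-mass of the added points. *)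
Lemma Err_setU (S : set T) : measurable S ->
  Err D S - Err D (S `|` P) =
  (1 - rho) * (fine (Q (P `\` S)) / fine (Q P)) - rho * fine (U (P `\` S)).
Proof.
move=> mS; have mSP := measurableU _ _ mS mP.
rewrite !Err_mixture// !fine_truncation//; try exact: measurableC.
rewrite (_ : ~` (S `|` P) `&` P = set0); last first.
  by rewrite setCU -setIA [~` P `&` P]setIC setICr setI0.
rewrite (_ : ~` S `&` P = P `\` S); last by rewrite setIC.
rewrite (fine_probabilityDI U _ _ mSP mS) setDUl setDv set0U setUK.
by rewrite measure0 mul0r; lra.
Qed.

Variable Sopt : set T.
Hypothesis Sopt_min : is_argmin_Err D Sopt.

Lemma false_positives_le_excess (S : set T) : measurable S ->
  rho * fine (U (S `\` P)) <= Err D S - Err D Sopt.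
Proof.
move=> mS; rewrite -Err_setI// lerB//.
by apply: Sopt_min.2; exact: measurableI.
Qed.

Lemma false_negatives_le_excess (S : set T) : measurable S ->
  (1 - rho) * fine (Q (P `\` S)) <= Err D S - Err D Sopt + rho.
Proof.
move=> mS; have mPS := measurableD mP mS; case/andP: rho01 => r0 r1.
have : Err D S - Err D (S `|` P) <= Err D S - Err D Sopt.
  by rewrite lerB//; apply: Sopt_min.2; exact: measurableU.
rewrite Err_setU//.
have QP_gt0 : 0 < fine (Q P).
  by rewrite fine_gt0// QP0 ltey_eq fin_num_measure.
have : fine (Q (P `\` S)) <= fine (Q (P `\` S)) / fine (Q P).
  rewrite ler_pdivlMr// ler_piMr ?fine_probability_ge0//.
  exact: fine_probability_le1.
have := fine_probability_le1 U _ mPS.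
nra.
Qed.

End positive_unlabeled_error.

Theorem theorem3p9 (R : realType) :
  exists c1 c2 : R, [/\ 0 < c1, 0 < c2 &
  forall (d : nat) (C : R) (P : set (Rd R d)) (Q U : probability (Rd R d) R)
    (rho : R) (mP : measurable P),
  1 <= C ->
  has_density Q -> has_density U ->
  (0 < Q P)%E ->
  measure_support U = measure_support Q ->
  (forall T : set (Rd R d), measurable T ->
     expR (- C) * fine (U T) `^ C <= fine (Q T) /\
     fine (Q T) <= expR C * fine (U T) `^ C^-1) ->
  0 < rho -> rho < (3 * C)^-1 ->
  let D := mixture rho (labeled U false) (labeled (truncation Q mP) true) in
  forall S S_opt : set (Rd R d),
  measurable S -> is_argmin_Err D S_opt ->
  fine (Q (S `+` P)) <=
    c1 * rho + c2 * (expR C / rho) * (Err D S - Err D S_opt) `^ C^-1].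
Proof.
(* [3 / 2] bounds [1 / (1 - rho)] for [rho < 1 / 3]; [5 / 2] is 1 from the false positives plus
   [3 / 2] from the false negatives. *)
exists (3 / 2), (5 / 2); split; [lra|lra|].
move=> d C P Q U rho mP C1 _ _ QP0 _ QU r0 rC D S Sopt mS Sopt_min.
have C0 : 0 < C by lra.
have C'01 : 0 < C^-1 <= 1 by rewrite invr_gt0 C0 invf_le1.
have r3 : rho < 1 / 3.
  apply: (lt_le_trans rC); rewrite div1r lef_pV2 ?posrE ?mulr_gt0//.
  by rewrite ler_peMr.
have r01 : 0 < rho < 1 by rewrite r0; lra.
have := false_positives_le_excess rho Q U P mP QP0 _ Sopt_min S mS.
have := false_negatives_le_excess rho Q U P mP r01 QP0 _ Sopt_min S mS.
rewrite -/D; set e := Err D S - Err D Sopt.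
have mSP := measurableD mS mP; have mPS := measurableD mP mS.
move=> fneg fpos.
have e0 : 0 <= e by rewrite subr_ge0; exact: Sopt_min.2.
have e1 : e <= 1.
  rewrite lerBlDr -[leLHS]addr0 lerD//; first exact: Err_le1.
  by apply: Err_ge0 => //; exact: Sopt_min.1.
have powR_ge (x : R) : 0 <= x <= 1 -> x <= x `^ C^-1.
  (* Zero is treated apart because [ger_powR] needs a positive base. *)
  case/andP => x0 x1; have [->|xN0] := eqVneq x 0; first exact: powR_ge0.
  rewrite -[leLHS]powRr1//; apply: ger_powR; last by case/andP: C'01.
  by rewrite lt_neqAle eq_sym xN0 x0.
have K1 : 1 <= expR C / rho.
  rewrite ler_pdivlMr// mul1r (@le_trans _ _ 1)//; first lra.
  by rewrite -expR0 ler_expR ltW.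
have QSP : fine (Q (S `\` P)) <= expR C / rho * e `^ C^-1.
  apply: (le_trans (QU _ mSP).2); rewrite -mulrA ler_pM2l ?expR_gt0//.
  apply: (@le_trans _ _ ((rho^-1 * e) `^ C^-1)).
    rewrite ge0_ler_powR ?nnegrE ?mulr_ge0 ?invr_ge0 ?(ltW C0) ?(ltW r0)//.
      exact: fine_probability_ge0.
    by rewrite ler_pdivlMl.
  (* The factor [rho^-1] is at least 1, so its power [C^-1] is at most [rho^-1] itself. *)
  rewrite powRM ?invr_ge0 ?(ltW r0)// ler_wpM2r ?powR_ge0//.
  rewrite -[leRHS]powRr1 ?invr_ge0 ?(ltW r0)//.
  apply: ler_powR; last by case/andP: C'01.
  by rewrite invf_ge1//; lra.
have QPS : fine (Q (P `\` S)) <= 3 / 2 * (rho + e).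
  by have := fine_probability_ge0 Q (P `\` S); nra.
(* This absorbs the linear excess left by the false negatives into the power term. *)
have ee : e <= expR C / rho * e `^ C^-1.
  apply: (le_trans (powR_ge _ _)); first by rewrite e0.
  by rewrite ler_peMl ?powR_ge0.
rewrite setY_def measureU//; last first.
  by apply/seteqP; split => x // -[[_ nPx] [Px _]].
rewrite fineD ?fin_num_measure//.
lra.
Qed.
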